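(* Let $n\ge 1$ and $k$ be integers with $n/2\le k < n$. Then $\mathcal{N}(n,k)\simeq \Sigma^2\,\mathcal{N}(k,2k-n)$.
   Context: For $n\ge1$ and integers $i\le j$, $[i,j]_n$ is the image of $\{i,i+1,\dots,j\}$ under $\mathbb{Z}\to\mathbb{Z}/n$. For $n\ge1$, $k\ge0$, the nerve complex $\mathcal{N}(n,k)$ is the simplicial complex with vertex set $\{0,\dots,n-1\}$ (identified with $\mathbb{Z}/n$) whose maximal simplices are the sets $[i,i+k]_n$, $i=0,\dots,n-1$. Simplicial complexes are identified with their geometric realizations, $\simeq$ denotes homotopy equivalence, and $\Sigma$ denotes unreduced suspension, with $\Sigma^2=\Sigma\Sigma$. *)

(* Defs.v *)
From HB Require Import structures.
From mathcomp Require Import all_boot all_order all_algebra generic_quotient.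
From mathcomp Require Import all_classical all_reals all_analysis.

Set Implicit Arguments.
Unset Strict Implicit.
Unset Printing Implicit Defensive.

Import Order.TTheory GRing.Theory Num.Theory.
Import numFieldNormedType.Exports.

Local Open Scope classical_set_scope.
Local Open Scope ring_scope.
Local Open Scope quotient_scope.

Section UnitInterval.
Context (R : realType).

Definition unit_interval : set R := `[0, 1]%classic.

Lemma unit_interval0 : 0 \in unit_interval.
Proof. by rewrite inE /unit_interval/= in_itv/= lexx ler01. Qed.

Lemma unit_interval1 : 1 \in unit_interval.
Proof. by rewrite inE /unit_interval/= in_itv/= lexx ler01. Qed.

Definition ui0 : unit_interval := exist _ 0 unit_interval0.
Definition ui1 : unit_interval := exist _ 1 unit_interval1.

End UnitInterval.

Arguments unit_interval : clear implicits.
Arguments ui0 : clear implicits.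
Arguments ui1 : clear implicits.

Section Homotopy.
Context (R : realType).

Definition homotopic (X Y : topologicalType) (f g : X -> Y) : Prop :=
  exists H : X * unit_interval R -> Y,
    [/\ continuous H,
        forall x, H (x, ui0 R) = f x &
        forall x, H (x, ui1 R) = g x].

Definition homotopy_equivalent (X Y : topologicalType) : Prop :=
  exists (f : X -> Y) (g : Y -> X),
    [/\ continuous f, continuous g,
        homotopic (g \o f) idfun &
        homotopic (f \o g) idfun].

End Homotopy.

Section Suspension.
Context (R : realType) (X : topologicalType).
Implicit Types a b : X * unit_interval R.

Let suspension_rel' a b :=
  [|| a == b, (a.2 == ui0 R) && (b.2 == ui0 R) |
      (a.2 == ui1 R) && (b.2 == ui1 R)].

Let suspension_rel_refl : reflexive suspension_rel'.
Proof. by move=> a; rewrite /suspension_rel' eqxx. Qed.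

Let suspension_rel_sym : symmetric suspension_rel'.
Proof.
move=> a b; rewrite /suspension_rel' eq_sym.
by congr [|| _, _ | _]; rewrite andbC.
Qed.

Let suspension_rel_trans : transitive suspension_rel'.
Proof.
have neq01 : ui0 R == ui1 R = false.
  by apply/negP => /eqP /(congr1 val) /= /eqP; rewrite eq_sym oner_eq0.
move=> b a c; rewrite /suspension_rel'.
move=> /or3P[/eqP-> //|/andP[/eqP a0 /eqP b0]|/andP[/eqP a1 /eqP b1]].
- move=> /or3P[/eqP<-|/andP[_ /eqP c0]|/andP[/eqP b1 _]].
  + by rewrite a0 b0 !eqxx orbT.
  + by rewrite a0 c0 !eqxx orbT.
  + by move: neq01; rewrite -b0 b1 eqxx.
- move=> /or3P[/eqP<-|/andP[/eqP b0 _]|/andP[_ /eqP c1]].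
  + by rewrite a1 b1 !eqxx !orbT.
  + by move: neq01; rewrite -b0 b1 eqxx.
  + by rewrite a1 c1 !eqxx !orbT.
Qed.

Definition suspension_rel :=
  EquivRel _ suspension_rel_refl suspension_rel_sym suspension_rel_trans.

(* This has the two suspension points only if X is nonempty: the empty space
   is sent to the empty space and not, as in some conventions, to S^0. *)
Definition suspension := {eq_quot suspension_rel}.

HB.instance Definition _ :=
  Topological.copy suspension (quotient_topology suspension).
HB.instance Definition _ := Quotient.on suspension.

End Suspension.

Record simplicial_complex (V : finType) := SimplicialComplex {
  simplices : {set {set V}};
  simplices_neq0 : finset.set0 \notin simplices;
  simplices_vertex : forall v, [set v]%SET \in simplices;
  simplices_sub : forall A B : {set V}, B \in simplices -> A \subset B ->
    A != finset.set0 -> A \in simplices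
}.

Section Realization.
Context (R : realType) (V : finType) (K : simplicial_complex V).

(* Barycentric coordinates; V being finite, the topology of the realization is
   the one induced by the product topology on the functions from V to R. *)
Definition realization_set : set {ptws V -> R} :=
  [set x : {ptws V -> R} | [/\ forall v, 0 <= x v, \sum_v x v = 1 &
                               [set v | x v != 0]%SET \in simplices K]].

Definition realization : Type := set_type realization_set.

HB.instance Definition _ :=
  Topological.copy realization (set_type realization_set).

End Realization.

(* The set [i, j]_n, as a subset of the representatives 0, ..., n-1 of Z/n. *)
Definition cyclic_interval (n : nat) (i j : int) : {set 'I_n} :=
  [set v : 'I_n | `[< exists2 m : int, i <= m <= j &
                                       (m = v%:Z %[mod n])%Z >]]%SET.

Section NerveComplex.
Context (n k : nat).

Definition nerve_simplices : {set {set 'I_n}} :=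
  [set A : {set 'I_n} | (A != finset.set0) &&
    [exists i : 'I_n, A \subset cyclic_interval n i%:Z (i%:Z + k%:Z)]]%SET.

Let nerve_neq0 : finset.set0 \notin nerve_simplices.
Proof. by rewrite inE eqxx. Qed.

Let nerve_vertex v : [set v]%SET \in nerve_simplices.
Proof.
rewrite inE; apply/andP; split; first by apply/set0Pn; exists v; rewrite inE.
apply/existsP; exists v; rewrite finset.sub1set inE; apply/asboolP.
by exists v%:Z => //; rewrite lexx lerDl.
Qed.

Let nerve_sub (A B : {set 'I_n}) : B \in nerve_simplices -> A \subset B ->
  A != finset.set0 -> A \in nerve_simplices.
Proof.
rewrite !inE => /andP[_ /existsP[i Bi]] AB ->.
by apply/existsP; exists i; exact: fintype.subset_trans AB Bi.
Qed.

Definition nerve_complex : simplicial_complex 'I_n :=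
  SimplicialComplex nerve_neq0 nerve_vertex nerve_sub.

End NerveComplex.

(* Main.v *)
From HB Require Import structures.
From mathcomp Require Import all_boot all_order all_algebra generic_quotient.
From mathcomp Require Import all_classical all_reals all_analysis.
From mathcomp Require Import ring lra zify.
Require Import Defs.

(** Put w = n - k - 1, so that 2w + 2 <= n. A nonempty set is a simplex of
    N(n, k) exactly when it misses a window of w cyclically consecutive
    vertices, and N(k, 2k - n) is the complex of the same kind, with the same
    w, on k = n - w - 1 vertices. So the claim is that removing w + 1 vertices
    from the circle desuspends the complex twice.

    Each suspension comes from a decomposition of a complex into two
    contractible subcomplexes, by the general fact that the union of
    contractible A and B is homotopy equivalent to the suspension of their
    intersection: add to the union a cone on A and a cone on B. The result
    collapses back to the union, since A and B are contractible; it also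
    collapses to the two cones on the intersection, since every simplex
    outside B can be cancelled against its join with the apex of the cone on
    A, and vice versa ([union_equivalent_susp], [susp_union_equivalent_susp]).

    For the first suspension, A consists of the sets missing a window that
    avoids the vertex 0, and B of the sets missing a window around 0; both are
    cones, with apex 0 and w + 1 ([inner_window_collapses],
    [wrap_window_collapses]). Their intersection is a union again
    ([inner_wrap_windows]): of the full simplex C on the vertices w + 1, ...,
    n - 1, and of the complex D of the sets missing a window around 0 together
    with a window that starts strictly after the former ends. C is a cone, D
    is collapsible because its vertices n - 1, n - 2, ..., n - w are
    successively dominated ([separated_windows_collapses]), and the
    intersection of C and D is N(k, 2k - n) with its vertices shifted by w + 1
    ([renames_gap_separated]).

    All collapses are compositions of steps in which the removed simplices are
    matched by inserting or deleting one fixed vertex ([toggles]). Such a step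
    is a sequence of elementary collapses, each of which is realized by a
    straight-line homotopy in barycentric coordinates ([elementary_collapse],
    [toggles_equivalent]).

    Finally the topological suspension of a polyhedron is homeomorphic to the
    polyhedron of the simplicial suspension, since the evident map is a
    continuous bijection from a compact space to a Hausdorff one
    ([suspension_polyhedron]). As homeomorphisms, unlike homotopies, pass to
    suspensions at once, this can be iterated. *)

Set Implicit Arguments.
Unset Strict Implicit.
Unset Printing Implicit Defensive.

Import Order.TTheory GRing.Theory Num.Theory.
Import numFieldNormedType.Exports.

Local Open Scope classical_set_scope.
Local Open Scope ring_scope.

(** * Continuity, homeomorphisms and homotopies *)

Lemma continuous_into_set_type (X Y : topologicalType) (A : set Y)
    (f : X -> A) : continuous (set_val \o f) -> continuous f.
Proof.
move=> cf x U [_ [[W oW <-] /= Wx sWU]].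
have : nbhs (set_val (f x)) W by apply: open_nbhs_nbhs; split.
move=> /(cf x); apply: (@filterS _ (nbhs x)) => y; exact: sWU.
Qed.

Lemma continuous_set_val (Y : topologicalType) (A : set Y) :
  continuous (set_val : A -> Y).
Proof. exact: initial_continuous. Qed.

Lemma continuous_into_ptws (X Y : topologicalType) (I : Type)
    (f : X -> {ptws I -> Y}) : (forall i, continuous (fun x => f x i)) ->
  continuous f.
Proof.
move=> cf x.
apply/cvg_sup => i.
move=> U [_ [[W oW <-] /= Wx sWU]].
have : nbhs (f x i) W by apply: open_nbhs_nbhs; split.
move=> /(cf i x); apply: (@filterS _ (nbhs x)) => y; exact: sWU.
Qed.

Lemma continuous_ptws_eval (I : eqType) (Y : topologicalType) (i : I) :
  continuous (fun f : {ptws I -> Y} => f i).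
Proof. exact: (@proj_continuous I (fun=> Y) i). Qed.

(** A filter on the subtype is pushed forward to the ambient space;
    neighbourhoods in the subtype are traces of ambient ones, so a cluster
    point of the image that lies in A is a cluster point of the filter. *)
Lemma set_type_compact (Y : topologicalType) (A : set Y) :
  compact A -> compact [set: A].
Proof.
move=> cA F FF _.
have FA : ((set_val : A -> Y) @ F) A.
  apply: (@filterS _ F _ setT) => [[a aA] _ /=|]; first exact: set_mem.
  exact: filterT.
have [y [Ay cy]] := cA _ (fmap_proper_filter _ FF) FA.
exists (exist _ y (mem_set Ay)); split => // P U FP [_ [[W oW <-] /= Wy sWU]].
have [||z [[a Pa <-] Wz]] := cy (set_val @` P) W.
- by apply: (@filterS _ F _ P) => // a Pa /=; exists a.
- by apply: open_nbhs_nbhs; split.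
- by exists a; split => //; exact: sWU.
Qed.

Lemma hausdorff_injective (X Y : topologicalType) (f : X -> Y) :
  continuous f -> injective f -> hausdorff_space Y -> hausdorff_space X.
Proof.
move=> cf injf hY p q pq; apply: injf; apply: hY => P U Pp Uq.
have [z [Pz Uz]] := pq _ _ (cf _ _ Pp) (cf _ _ Uq).
by exists (f z).
Qed.

Lemma continuous_pair (X Y Z : topologicalType) (f : X -> Y) (g : X -> Z) :
  continuous f -> continuous g -> continuous (fun x => (f x, g x)).
Proof. by move=> cf cg x; apply: cvg_pair; [exact: cf|exact: cg]. Qed.

Lemma continuous_after (X Y Z : topologicalType) (g : Y -> Z) (f : X -> Y) :
  continuous g -> continuous f -> continuous (fun x => g (f x)).
Proof. by move=> cg cf x; apply: continuous_comp; [exact: cf|exact: cg]. Qed.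

Lemma continuous_fst (X Y : topologicalType) : continuous (@fst X Y).
Proof. by move=> x; exact: cvg_fst. Qed.

Lemma continuous_snd (X Y : topologicalType) : continuous (@snd X Y).
Proof. by move=> x; exact: cvg_snd. Qed.

Definition homeomorphic (X Y : topologicalType) : Prop :=
  exists (f : X -> Y) (g : Y -> X),
    [/\ continuous f, continuous g, cancel f g & cancel g f].

Lemma homeomorphic_trans (Y X Z : topologicalType) :
  homeomorphic X Y -> homeomorphic Y Z -> homeomorphic X Z.
Proof.
move=> [f [g [cf cg fK gK]]] [f' [g' [cf' cg' fK' gK']]].
exists (f' \o f), (g \o g'); split.
- by move=> x; apply: continuous_comp; [exact: cf|exact: cf'].
- by move=> x; apply: continuous_comp; [exact: cg'|exact: cg].
- exact: can_comp.
- exact: can_comp.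
Qed.

Lemma compact_hausdorff_homeomorphic (X Y : topologicalType) (f : X -> Y) :
  compact [set: X] -> hausdorff_space Y -> continuous f -> injective f ->
  (forall y, exists x, f x = y) -> homeomorphic X Y.
Proof.
move=> cX hY cf injf surjf.
pose g y := sval (cid (surjf y)).
have gK : cancel g f by move=> y; rewrite /g; case: cid.
have fK : cancel f g by move=> x; apply: injf; rewrite gK.
exists f, g; split => //.
apply/continuous_closedP => C clC.
have -> : g @^-1` C = f @` C.
  rewrite eqEsubset; split => [y Cy|_ [x Cx <-]] /=; last by rewrite fK.
  by exists (g y) => //; rewrite gK.
apply: compact_closed => //; apply: continuous_compact.
  exact: continuous_subspaceT.
exact: subclosed_compact cX _.
Qed.

Section Homotopy.
Variable R : realType.
Local Notation I := (unit_interval R).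
Local Notation homotopic := (homotopic R).
Local Notation homotopy_equivalent := (homotopy_equivalent R).

(** Clamping to the unit interval lets the two halves of a concatenated
    homotopy be written as continuous maps defined for all times. *)
Lemma clamp_subproof (r : R) : Num.max 0 (Num.min 1 r) \in I.
Proof.
rewrite inE /unit_interval /= in_itv /= le_max lexx /= ge_max ler01 /=.
by rewrite ge_min lexx.
Qed.

Definition clamp (r : R) : I :=
  exist (fun x : R => x \in I) _ (clamp_subproof r).

Lemma clamp_continuous : continuous clamp.
Proof.
apply: continuous_into_set_type => r.
apply: (@continuous_max _ _ (cst 0) (fun r : R => Num.min 1 r)).
  exact: cst_continuous.
by apply: (@continuous_min _ _ (cst 1) id) => //; exact: cst_continuous.
Qed.

Lemma unit_intervalP (t : I) : 0 <= set_val t <= 1.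
Proof. by have := set_valP t; rewrite /unit_interval /= in_itv /=. Qed.

Lemma clamp_le0 r : r <= 0 -> clamp r = ui0 R.
Proof.
move=> r0; apply: val_inj => /=; apply/max_idPl.
by rewrite ge_min r0 orbT.
Qed.

Lemma clamp_ge1 r : 1 <= r -> clamp r = ui1 R.
Proof.
by move=> r1; apply: val_inj => /=; rewrite (min_idPl r1); apply/max_idPr.
Qed.

Lemma homotopic_refl (X Y : topologicalType) (f : X -> Y) :
  continuous f -> homotopic f f.
Proof.
move=> cf; exists (f \o fst); split => // x.
by apply: continuous_comp; [exact: cvg_fst|exact: cf].
Qed.

Lemma homotopic_comp (X Y Z W : topologicalType) (f g : X -> Y)
    (h : W -> X) (k : Y -> Z) : continuous h -> continuous k ->
  homotopic f g -> homotopic (k \o f \o h) (k \o g \o h).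
Proof.
move=> ch ck [H [cH H0 H1]].
exists (fun p => k (H (h p.1, p.2))); split; last first.
- by move=> x /=; rewrite H1.
- by move=> x /=; rewrite H0.
apply: continuous_after ck _; apply: continuous_after cH _.
apply: continuous_pair; last exact: continuous_snd.
by apply: continuous_after ch _; exact: continuous_fst.
Qed.

Lemma homotopic_trans (X Y : topologicalType) (g f h : X -> Y) :
  homotopic f g -> homotopic g h -> homotopic f h.
Proof.
move=> [H [cH H0 H1]] [K [cK K0 K1]].
pose H' (p : X * I) := H (p.1, clamp (2 * set_val p.2)).
pose K' (p : X * I) := K (p.1, clamp (2 * set_val p.2 - 1)).
have cval : continuous (fun p : X * I => set_val p.2).
  by apply: continuous_after (@continuous_snd _ _); exact: continuous_set_val.
have c2 : continuous (fun p : X * I => 2 * set_val p.2).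
  by move=> p; apply: cvgM; [exact: cvg_cst|exact: cval].
have cH' : continuous H'.
  apply: continuous_after cH _; apply: continuous_pair (@continuous_fst _ _) _.
  exact: continuous_after clamp_continuous c2.
have cK' : continuous K'.
  apply: continuous_after cK _; apply: continuous_pair (@continuous_fst _ _) _.
  apply: continuous_after clamp_continuous _.
  by move=> p; apply: cvgB; [exact: c2|exact: cvg_cst].
pose J p := if set_val p.2 <= 2^-1 then H' p else K' p.
exists J; split; last first.
- move=> x; rewrite /J /K' -[set_val (x, ui1 R).2]/(1 : R) ifF; last first.
    by apply/negbTE; rewrite -ltNge; lra.
  by rewrite clamp_ge1 //=; lra.
- move=> x; rewrite /J /H' -[set_val (x, ui0 R).2]/(0 : R) ifT; last by lra.
  by rewrite clamp_le0 //=; lra.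
apply/continuous_subspace_setT.
pose P := [set p : X * I | set_val p.2 <= 2^-1].
pose Q := [set p : X * I | set_val p.2 >= 2^-1].
have -> : setT = P `|` Q.
  rewrite eqEsubset; split => // p _; rewrite /P /Q /=.
  by have [|/ltW] := leP (set_val p.2) 2^-1; [left|right].
apply: withinU_continuous.
- rewrite /P (_ : [set _ | _] =
    (fun p : X * I => set_val p.2) @^-1` [set r | r <= 2^-1]) //.
  by move/continuous_closedP: cval; apply; exact: closed_le.
- rewrite /Q (_ : [set _ | _] =
    (fun p : X * I => set_val p.2) @^-1` [set r | r >= 2^-1]) //.
  by move/continuous_closedP: cval; apply; exact: closed_ge.
- apply: (@subspace_eq_continuous _ P _ H'); last exact: continuous_subspaceT.
  by move=> p /set_mem Pp; rewrite /from_subspace /J ifT.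
- apply: (@subspace_eq_continuous _ Q _ K'); last exact: continuous_subspaceT.
  move=> p /set_mem hp; rewrite /from_subspace /J; case: ifP => // hp'.
  have e : set_val p.2 = 2^-1 by apply/eqP; rewrite eq_le hp hp'.
  rewrite /H' /K' e clamp_le0; last by lra.
  by rewrite clamp_ge1 ?H1 ?K0 //; lra.
Qed.

Lemma homotopy_equivalent_sym (X Y : topologicalType) :
  homotopy_equivalent X Y -> homotopy_equivalent Y X.
Proof. by move=> [f [g [cf cg gf fg]]]; exists g, f. Qed.

Lemma homotopy_equivalent_trans (Y X Z : topologicalType) :
  homotopy_equivalent X Y -> homotopy_equivalent Y Z ->
  homotopy_equivalent X Z.
Proof.
move=> [f [g [cf cg gf fg]]] [f' [g' [cf' cg' gf' fg']]].
exists (f' \o f), (g \o g'); split.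
- by move=> x; apply: continuous_comp; [exact: cf|exact: cf'].
- by move=> x; apply: continuous_comp; [exact: cg'|exact: cg].
- apply: homotopic_trans gf; exact: (homotopic_comp cf cg gf').
- apply: homotopic_trans fg'; exact: (homotopic_comp cg' cf' fg).
Qed.

Lemma homeomorphic_homotopy_equivalent (X Y : topologicalType) :
  homeomorphic X Y -> homotopy_equivalent X Y.
Proof.
move=> [f [g [cf cg fK gK]]]; exists f, g; split => //.
- rewrite (_ : g \o f = idfun); last by apply/funext => x /=; rewrite fK.
  by apply: homotopic_refl => x; exact: cvg_id.
- rewrite (_ : f \o g = idfun); last by apply/funext => x /=; rewrite gK.
  by apply: homotopic_refl => x; exact: cvg_id.
Qed.

End Homotopy.

(** * Polyhedra of families of sets *)

(** Complexes are handled as down-closed families of finite sets in which the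
    empty set is allowed. With the empty simplex present, a cone collapses to
    the empty family by the same matching as any other collapse, and no vertex
    needs to be singled out. Vertices that span no simplex are allowed as
    well, so that subcomplexes live on the same vertex set. *)
Definition downclosed (V : finType) (F : {set V} -> Prop) :=
  forall S T : {set V}, S \subset T -> F T -> F S.

(** The sets of F outside G are matched in pairs that differ by the vertex v.
    For down-closed families these two conditions suffice: deleting v stays in
    F, and adding v stays outside G. *)
Definition toggles (V : finType) (F G : {set V} -> Prop) (v : V) :=
  (forall S, G S -> F S) /\
  (forall S, F S -> ~ G S -> F (v |: S)%SET /\ ~ G (S :\ v)%SET).

Inductive collapses (V : finType) (F : {set V} -> Prop) :
    ({set V} -> Prop) -> Prop :=
| Collapses_refl : collapses F F
| Collapses_step G H v : collapses F G -> downclosed H -> toggles G H v ->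
    collapses F H.

Section Polyhedron.
Variable R : realType.
Implicit Types V : finType.

Definition supp V (x : V -> R) : {set V} := [set v | x v != 0]%SET.

Definition polyhedron_set V (F : {set V} -> Prop) : set {ptws V -> R} :=
  [set x : {ptws V -> R} |
    [/\ forall v, 0 <= x v, \sum_v x v = 1 & F (supp x)]].

Definition polyhedron V (F : {set V} -> Prop) := set_type (polyhedron_set F).

HB.instance Definition _ V (F : {set V} -> Prop) :=
  Topological.copy (polyhedron F) (set_type (polyhedron_set F)).

Definition coord V (F : {set V} -> Prop) (x : polyhedron F) (v : V) : R :=
  (set_val x : V -> R) v.

Lemma coord_continuous V (F : {set V} -> Prop) v :
  continuous (fun x : polyhedron F => coord x v).
Proof.
apply: (@continuous_after _ _ _ (fun f : {ptws V -> R} => f v)).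
  exact: continuous_ptws_eval.
exact: continuous_set_val.
Qed.

Lemma polyhedron_continuous (X : topologicalType) V (F : {set V} -> Prop)
    (f : X -> polyhedron F) :
  (forall v, continuous (fun x => coord (f x) v)) -> continuous f.
Proof.
move=> cf; apply: continuous_into_set_type.
exact: continuous_into_ptws.
Qed.

Section Coord.
Context V (F : {set V} -> Prop).
Implicit Type x : polyhedron F.

Lemma coordP x :
  [/\ forall v, 0 <= coord x v, \sum_v coord x v = 1 & F (supp (coord x))].
Proof. by case: x => x xF; exact: set_mem xF. Qed.

Lemma coord_ge0 x v : 0 <= coord x v.
Proof. by have [x0 x1 xF] := coordP x. Qed.

Lemma coord_sum x : \sum_v coord x v = 1.
Proof. by have [x0 x1 xF] := coordP x. Qed.

Lemma coord_supp x : F (supp (coord x)).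
Proof. by have [x0 x1 xF] := coordP x. Qed.

Lemma coord_inj x y : coord x =1 coord y -> x = y.
Proof. by move=> xy; apply: val_inj; apply/funext => v; exact: xy. Qed.

Lemma coord_le1 x v : coord x v <= 1.
Proof.
rewrite -(coord_sum x) (bigD1 v) //= lerDl sumr_ge0 // => u _.
exact: coord_ge0.
Qed.

Definition mk_polyhedron (x : V -> R) (x0 : forall v, 0 <= x v)
    (x1 : \sum_v x v = 1) (xF : F (supp x)) : polyhedron F :=
  exist (fun x : {ptws V -> R} => x \in polyhedron_set F) x
    (mem_set (And3 x0 x1 xF)).

Lemma coord_mk (y : V -> R) y0 y1 yF v :
  coord (@mk_polyhedron y y0 y1 yF) v = y v.
Proof. by []. Qed.
End Coord.

Lemma supp_neq0 V (x : V -> R) : \sum_v x v = 1 -> supp x != finset.set0.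
Proof.
move=> x1; apply/negP => /eqP/setP s0; have := oner_neq0 R.
rewrite -x1 big1 ?eqxx // => v _; have := s0 v.
by rewrite !inE => /negbFE/eqP.
Qed.

Lemma polyhedron_ext V (F G : {set V} -> Prop) :
  (forall S, S != finset.set0 -> F S <-> G S) ->
  polyhedron_set F = polyhedron_set G.
Proof.
move=> FG; rewrite predeqE => x.
by split=> -[x0 x1 xF]; split => //; apply/FG => //; exact: supp_neq0.
Qed.

(** A point on the segment from f x to g x is supported in the union of the
    two supports, which is a simplex by hypothesis. *)
Lemma straight_line_homotopic V (F : {set V} -> Prop) (X : topologicalType)
    (f g : X -> polyhedron F) : downclosed F -> continuous f -> continuous g ->
  (forall x, F (supp (coord (f x)) :|: supp (coord (g x)))%SET) ->
  homotopic R f g.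
Proof.
move=> dF cf cg fg.
pose h (p : X * unit_interval R) v :=
  (1 - set_val p.2) * coord (f p.1) v + set_val p.2 * coord (g p.1) v.
have h0 p v : 0 <= h p v.
  have /andP[t0 t1] := unit_intervalP p.2.
  by apply: addr_ge0; apply: mulr_ge0; rewrite ?coord_ge0 ?subr_ge0.
have h1 p : \sum_v h p v = 1.
  rewrite big_split /= -!mulr_sumr !coord_sum; ring.
have hF p : F (supp (h p)).
  apply: dF (fg p.1); apply/fintype.subsetP => v; rewrite !inE.
  apply: contraR; rewrite negb_or !negbK /h => /andP[/eqP -> /eqP ->].
  by rewrite !mulr0 addr0.
exists (fun p => mk_polyhedron (h0 p) (h1 p) (hF p)); split.
- apply: polyhedron_continuous => v.
  have cv : continuous (fun p : X * unit_interval R => set_val p.2 : R).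
    by apply: continuous_after (@continuous_snd _ _); exact: continuous_set_val.
  have cc (k : X -> polyhedron F) : continuous k ->
      continuous (fun p : X * unit_interval R => coord (k p.1) v).
    move=> ck; apply: (@continuous_after _ _ _ (fun y => coord y v)).
      exact: coord_continuous.
    exact: continuous_after ck (@continuous_fst _ _).
  move=> p; rewrite /h; apply: cvgD; apply: cvgM.
  + by apply: cvgB; [exact: cvg_cst|exact: cv].
  + exact: cc.
  + exact: cv.
  + exact: cc.
- move=> x; apply: coord_inj => v; rewrite coord_mk /h /=.
  by rewrite -[set_val _]/(0 : R) subr0 mul1r mul0r addr0.
- move=> x; apply: coord_inj => v; rewrite coord_mk /h /=.
  by rewrite -[set_val _]/(1 : R) subrr mul1r mul0r add0r.
Qed.

Lemma continuous_id (X : topologicalType) : continuous (idfun : X -> X).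
Proof. by move=> x; exact: cvg_id. Qed.

Lemma continuousD_fun (X : topologicalType) (f g : X -> R) :
  continuous f -> continuous g -> continuous (fun x => f x + g x).
Proof. by move=> cf cg x; apply: cvgD; [exact: cf|exact: cg]. Qed.

Lemma continuousB_fun (X : topologicalType) (f g : X -> R) :
  continuous f -> continuous g -> continuous (fun x => f x - g x).
Proof. by move=> cf cg x; apply: cvgB; [exact: cf|exact: cg]. Qed.

Lemma continuousM_fun (X : topologicalType) (f g : X -> R) :
  continuous f -> continuous g -> continuous (fun x => f x * g x).
Proof. by move=> cf cg x; apply: cvgM; [exact: cf|exact: cg]. Qed.

Lemma continuous_max_fun (X : topologicalType) (f g : X -> R) :
  continuous f -> continuous g -> continuous (fun x => Num.max (f x) (g x)).
Proof.
by move=> cf cg x; apply: (@continuous_max R X f g); [exact: cf|exact: cg].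
Qed.

Lemma continuous_sum (X : topologicalType) (I : Type) (s : seq I)
    (P : pred I) (f : I -> X -> R) : (forall i, continuous (f i)) ->
  continuous (fun x => \sum_(i <- s | P i) f i x).
Proof.
move=> cf; elim: s => [|i s IH].
  rewrite (_ : (fun x => _) = cst 0); first exact: cst_continuous.
  by apply/funext => x; rewrite big_nil.
have -> : (fun x => \sum_(j <- i :: s | P j) f j x) =
    (fun x => (if P i then f i x else 0) + \sum_(j <- s | P j) f j x).
  by apply/funext => x; rewrite big_cons; case: (P i); rewrite ?add0r.
by apply: continuousD_fun IH; case: (P i); [exact: cf|exact: cst_continuous].
Qed.

Lemma continuous_bigmin (X : topologicalType) (I : Type) (s : seq I)
    (P : pred I) (f : I -> X -> R) : (forall i, continuous (f i)) ->
  continuous (fun x => \big[Num.min/1]_(i <- s | P i) f i x).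
Proof.
move=> cf; elim: s => [|i s IH].
  rewrite (_ : (fun x => _) = cst 1); first exact: cst_continuous.
  by apply/funext => x; rewrite big_nil.
case: (boolP (P i)) => Pi; last first.
  rewrite (_ : (fun x => _) = fun x => \big[Num.min/1]_(i <- s | P i) f i x) //.
  by apply/funext => x; rewrite big_cons (negbTE Pi).
rewrite (_ : (fun x => _) = fun x =>
    Num.min (f i x) (\big[Num.min/1]_(i <- s | P i) f i x)).
  by move=> x; apply: continuous_min; [exact: cf|exact: IH].
by apply/funext => x; rewrite big_cons Pi.
Qed.

(** Here v |: s is the only simplex properly containing s. A point is pushed
    away from the free face s by subtracting from its coordinates over s their
    minimum m and giving the removed mass to v. A point outside the interior
    of s and v |: s has m = 0 and does not move; since m is continuous on the
    whole polyhedron, no gluing is needed. *)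
Section ElementaryCollapse.
Variables (V : finType) (F : {set V} -> Prop) (s : {set V}) (v : V).
Hypotheses (dF : downclosed F) (s0 : s != finset.set0) (vs : v \notin s).
Hypothesis Fvs : F (v |: s)%SET.
Hypothesis free :
  forall T : {set V}, F T -> s \subset T -> T \subset (v |: s)%SET.
Let G T := F T /\ ~~ (s \subset T).

Let m (x : polyhedron F) : R := \big[Num.min/1]_(i in s) coord x i.

Let m_le x u : u \in s -> m x <= coord x u.
Proof. by move=> us; exact: bigmin_le_cond. Qed.

Let m_eq x : exists2 u, u \in s & m x = coord x u.
Proof.
have /set0Pn[u us] := s0.
rewrite /m (bigmin_eq_arg _ _ _ _ us) => [|i _]; last exact: coord_le1.
by case: Order.TotalTheory.arg_minP => //= w ws _; exists w.
Qed.

Let m_ge0 x : 0 <= m x.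
Proof. by have [u _ ->] := m_eq x; exact: coord_ge0. Qed.

Let m_gt0 x : m x != 0 -> s \subset supp (coord x).
Proof.
move=> mx; apply/fintype.subsetP => u us; rewrite inE gt_eqF //.
by apply: lt_le_trans (m_le x us); rewrite lt0r mx m_ge0.
Qed.

Let push (x : polyhedron F) u : R :=
  coord x u - (u \in s)%:R * m x + (u == v)%:R * (#|s|%:R * m x).

Let push_ge0 x u : 0 <= push x u.
Proof.
rewrite /push addr_ge0 ?mulr_ge0 ?ler0n //.
case: (boolP (u \in s)) => us; first by rewrite mul1r subr_ge0 m_le.
by rewrite mul0r subr0 coord_ge0.
Qed.

Let push_sum x : \sum_u push x u = 1.
Proof.
rewrite /push !big_split /= coord_sum sumrN -!mulr_suml.
rewrite (_ : \sum_i (i == v)%:R = 1 :> R); last first.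
  rewrite (bigD1 v) //= eqxx big1 ?addr0 // => i /negbTE -> //.
rewrite (_ : \sum_i (i \in s)%:R = #|s|%:R :> R); first by ring.
rewrite -sum1_card natr_sum [RHS]big_mkcond /=.
by apply: eq_bigr => i _; case: (i \in s).
Qed.

Let push_idem x : m x = 0 -> push x =1 coord x.
Proof. by move=> m0 u; rewrite /push m0 !mulr0 subr0 addr0. Qed.

Let push_supp_union x : F (supp (push x) :|: supp (coord x))%SET.
Proof.
have [m0|mn0] := eqVneq (m x) 0.
  rewrite (_ : supp (push x) = supp (coord x)) ?finset.setUid.
    exact: coord_supp.
  by apply/setP => u; rewrite !inE push_idem.
apply: dF Fvs; have sx := free (coord_supp x) (m_gt0 mn0).
rewrite finset.subUset sx andbT; apply/fintype.subsetP => u uS.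
have [uv|uv] := eqVneq u v; first by rewrite uv !inE eqxx.
apply: (fintype.subsetP sx); move: uS; rewrite !inE; apply: contra => /eqP xu.
have us : u \notin s.
  by apply/negP => /(fintype.subsetP (m_gt0 mn0)); rewrite inE xu eqxx.
by rewrite /push xu (negbTE us) (negbTE uv) !mul0r subr0 addr0.
Qed.

Let push_supp x : G (supp (push x)).
Proof.
split; first by apply: dF (push_supp_union x); exact: finset.subsetUl.
have [u us mu] := m_eq x; apply/negP => /fintype.subsetP/(_ u us).
rewrite inE /push us mul1r mu subrr add0r (_ : u == v = false) ?mul0r ?eqxx //.
by apply: contraNF vs => /eqP <-.
Qed.

Lemma elementary_collapse : homotopy_equivalent R (polyhedron F) (polyhedron G).
Proof.
have iF (y : polyhedron G) : F (supp (coord y)) by have [] := coord_supp y.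
pose r x : polyhedron G :=
  mk_polyhedron (push_ge0 x) (push_sum x) (push_supp x).
pose i y : polyhedron F := mk_polyhedron (coord_ge0 y) (coord_sum y) (iF y).
have cm : continuous m.
  by apply: continuous_bigmin => u; exact: coord_continuous.
have cpush u : continuous (fun x => push x u).
  have cc (a : R) : continuous (fun _ : polyhedron F => a).
    exact: cst_continuous.
  apply: continuousD_fun; last first.
    exact: continuousM_fun (cc _) (continuousM_fun (cc _) cm).
  apply: continuousB_fun; first exact: coord_continuous.
  exact: continuousM_fun (cc _) cm.
have cr : continuous r by exact: polyhedron_continuous.
have ci : continuous i.
  by apply: polyhedron_continuous => u; exact: coord_continuous.
exists r, i; split => //.
- apply: straight_line_homotopic => //.
  + exact: continuous_after ci cr.
  + exact: continuous_id.
- rewrite (_ : r \o i = idfun).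
    by apply: homotopic_refl; exact: continuous_id.
  apply/funext => y; apply: coord_inj => u /=; rewrite coord_mk push_idem //.
  apply/eqP; apply/negP => /negP /m_gt0 sy.
  by have [_ /negP] := coord_supp y.
Qed.
End ElementaryCollapse.

End Polyhedron.

(** * Collapses preserve the homotopy type *)

Section Collapse.
Variable R : realType.
Implicit Type V : finType.

Lemma polyhedron_eq_homeomorphic V (F G : {set V} -> Prop) :
  (forall S, S != finset.set0 -> F S <-> G S) ->
  homeomorphic (polyhedron R F) (polyhedron R G).
Proof.
move=> /(polyhedron_ext R) FG.
have -> : homeomorphic (polyhedron R F) (polyhedron R G) =
  homeomorphic (set_type (@polyhedron_set R V F))
               (set_type (@polyhedron_set R V G)) by [].
by rewrite FG; exists idfun, idfun; split => //; exact: continuous_id.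
Qed.

(** Among the removed sets that do not contain v, one of maximal cardinality,
    s, is a free face of v |: s: a removed set containing s is, v deleted, of
    the same kind as s and therefore equal to it. Collapsing this pair leaves
    a smaller instance of the same situation. The empty set must stay: without
    it the last step would remove a point altogether. *)
Lemma toggles_equivalent V (F G : {set V} -> Prop) v :
  downclosed F -> downclosed G -> G finset.set0 -> toggles F G v ->
  homotopy_equivalent R (polyhedron R F) (polyhedron R G).
Proof.
move=> + dG G0.
have [k] := ubnP #|[set S : {set V} | `[< F S /\ ~ G S >]]%SET|.
elim: k F => // k IH F + dF [GF tFG].
rewrite ltnS => Fk.
have [[S [FS nGS]]|nS] := pselect (exists S, F S /\ ~ G S); last first.
  apply: homeomorphic_homotopy_equivalent.
  apply: polyhedron_eq_homeomorphic => S _; split => [FS|]; last exact: GF.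
  by apply: contrapT => nGS; apply: nS; exists S.
have S'P : [&& v \notin (S :\ v)%SET, `[< F (S :\ v)%SET >] &
    `[< ~ G (S :\ v)%SET >]].
  have [_ nG] := tFG _ FS nGS.
  rewrite !inE eqxx /=; apply/andP; split; apply/asboolP => //.
  by apply: dF FS; exact: finset.subD1set.
case: (@arg_maxnP _ _ (fun T : {set V} =>
  [&& v \notin T, `[< F T >] & `[< ~ G T >]]) (fun T => #|T|) S'P) => s.
move=> /and3P[vs /asboolP Fs /asboolP nGs] smax.
have s0 : s != finset.set0 by apply/negP => /eqP s0; apply: nGs; rewrite s0.
have [Fvs _] := tFG _ Fs nGs.
have free (T : {set V}) : F T -> s \subset T -> T \subset (v |: s)%SET.
  move=> FT sT; have nGT : ~ G T by move=> /(dG _ _ sT).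
  have [_ nGT'] := tFG _ FT nGT.
  have sT' : s \subset (T :\ v)%SET by rewrite finset.subsetD1 sT.
  have e : s = (T :\ v)%SET.
    apply/eqP; rewrite eqEcard sT'; apply: smax.
    rewrite !inE eqxx /=; apply/andP; split; apply/asboolP => //.
    by apply: dF FT; exact: finset.subD1set.
  by rewrite e; apply/fintype.subsetP => u uT; rewrite !inE uT andbT orbN.
apply: homotopy_equivalent_trans (elementary_collapse R dF s0 vs Fvs free) _.
apply: IH.
- apply: leq_trans Fk; apply: proper_card; apply/properP; split.
    apply/fintype.subsetP => T; by rewrite !inE => -[[FT _] nGT].
  exists s; rewrite inE; apply/asboolP; first by split.
  by move=> [[_ /negP]].
- move=> T U TU [FU sU]; split; first exact: dF FU.
  by apply: contra sU => sT; exact: fintype.subset_trans TU.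
- split => [T GT|T [FT sT] nGT].
    split; first exact: GF.
    by apply/negP => /dG/(_ GT).
  have [FvT nG] := tFG _ FT nGT; split => //; split => //.
  apply: contra sT => /fintype.subsetP sT; apply/fintype.subsetP => u us.
  have := sT _ us; rewrite !inE => /predU1P[uv|//].
  by rewrite -uv us in vs.
Qed.

Lemma collapses_sub V (F G : {set V} -> Prop) :
  collapses F G -> forall S, G S -> F S.
Proof. by elim=> // {}G H v _ GF _ [HG _] S /HG/GF. Qed.

Lemma collapses_downclosed V (F G : {set V} -> Prop) :
  downclosed F -> collapses F G -> downclosed G.
Proof. by move=> dF; case. Qed.

Lemma collapses_equivalent V (F G : {set V} -> Prop) :
  downclosed F -> collapses F G -> G finset.set0 ->
  homotopy_equivalent R (polyhedron R F) (polyhedron R G).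
Proof.
move=> dF; elim=> [|{}G H v FG IH dH tGH H0].
  move=> _; apply: homeomorphic_homotopy_equivalent.
  exact: polyhedron_eq_homeomorphic.
apply: (homotopy_equivalent_trans (IH (tGH.1 _ H0))).
exact: toggles_equivalent (collapses_downclosed dF FG) dH H0 tGH.
Qed.

End Collapse.

(** * Renaming vertices, cones and simplicial suspensions *)

Definition renames (V W : finType) (phi : V -> W) (F : set {set V})
    (F' : set {set W}) :=
  injective phi /\ forall T : {set W}, F' T <->
    (forall w, w \in T -> exists v, w = phi v) /\ F (phi @^-1: T)%SET.

(** The vertices outside the image of phi carry no mass, so that barycentric
    coordinates are transported along phi by summing over its fibres. *)
Lemma renames_equivalent (R : realType) (V W : finType) (phi : V -> W) F F' :
  renames phi F F' ->
  homotopy_equivalent R (polyhedron R F) (polyhedron R F').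
Proof.
move=> [iphi F'E].
pose f (x : polyhedron R F) w : R := \sum_(v | phi v == w) coord x v.
have f_phi x v : f x (phi v) = coord x v.
  by rewrite /f (big_pred1 v) // => u; rewrite /= (inj_eq iphi).
have f0 x w : 0 <= f x w by apply: sumr_ge0 => v _; exact: coord_ge0.
have f1 x : \sum_w f x w = 1.
  by rewrite -(coord_sum x) (partition_big phi xpredT).
have fF x : F' (supp (f x)).
  apply/F'E; split => [w|].
    rewrite inE => fw; apply: contrapT => nv; move: fw.
    rewrite /f big_pred0 ?eqxx // => v; apply/eqP => vw.
    by apply: nv; exists v.
  rewrite (_ : _ @^-1: _ = supp (coord x))%SET; first exact: coord_supp.
  by apply/setP => v; rewrite !inE f_phi.
pose g (y : polyhedron R F') v : R := coord y (phi v).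
have gE y w : \sum_(v | phi v == w) g y v = coord y w.
  have [[v ->]|nv] := pselect (exists v, w = phi v).
    by rewrite (big_pred1 v) // => u; rewrite /= (inj_eq iphi).
  rewrite big_pred0 => [|v]; last by apply/eqP => vw; apply: nv; exists v.
  have [h _] := (F'E _).1 (coord_supp y).
  apply/esym/eqP/negPn/negP => yw; apply: nv; apply: h.
  by rewrite inE.
have g0 y v : 0 <= g y v by exact: coord_ge0.
have g1 y : \sum_v g y v = 1.
  rewrite -(coord_sum y) (partition_big phi xpredT) //=.
  by apply: eq_bigr => w _; rewrite gE.
have gF y : F (supp (g y)).
  have [_] := (F'E _).1 (coord_supp y).
  by congr F; apply/setP => v; rewrite !inE.
apply: homeomorphic_homotopy_equivalent.
exists (fun x => mk_polyhedron (f0 x) (f1 x) (fF x)).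
exists (fun y => mk_polyhedron (g0 y) (g1 y) (gF y)); split.
- apply: polyhedron_continuous => w.
  by apply: continuous_sum => v; exact: coord_continuous.
- by apply: polyhedron_continuous => v; exact: coord_continuous.
- by move=> x; apply: coord_inj => v; rewrite coord_mk /g coord_mk f_phi.
- by move=> y; apply: coord_inj => w; rewrite coord_mk /f gE.
Qed.

Section TwoCones.
Variable V : finType.
Implicit Types (X A B F : set {set V}) (T : {set (V + bool)}).

Definition base_trace T : {set V} := (inl @^-1: T)%SET.

(** The complex X together with a cone on A, of apex [inr false], and a cone
    on B, of apex [inr true]; it is used for subfamilies A and B of X. *)
Definition two_cones X A B : set {set (V + bool)} := fun T =>
  ~~ ((inr false \in T) && (inr true \in T)) /\
  (if inr false \in T then A else if inr true \in T then B else X)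
    (base_trace T).

Definition susp F := two_cones F F F.

Lemma suspE F T : susp F T <->
  ~~ ((inr false \in T) && (inr true \in T)) /\ F (base_trace T).
Proof. by rewrite /susp /two_cones !if_same. Qed.

Lemma two_cones_downclosed X A B :
  downclosed X -> downclosed A -> downclosed B ->
  A `<=` X -> B `<=` X -> downclosed (two_cones X A B).
Proof.
move=> dX dA dB AX BX S T ST [nT cT].
have ts : base_trace S \subset base_trace T by exact: preimsetS.
have sub : forall u, u \in S -> u \in T by exact/fintype.subsetP.
split.
  by apply: contra nT => /andP[/sub -> /sub ->].
case: ifP => [/sub Tf|_]; first by rewrite Tf in cT; exact: dA cT.
case: ifP => [/sub Tt|_].
  move: nT cT; rewrite Tt andbT => /negbTE ->; exact: dB.
apply: (dX _ _ ts); move: cT.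
by case: ifP => _ => [/AX//|]; case: ifP => _ => [/BX|].
Qed.

Lemma toggles_refl F v : toggles F F v.
Proof. by []. Qed.

Let traceU v T : base_trace (inl v |: T)%SET = (v |: base_trace T)%SET.
Proof. by apply/setP => u; rewrite !inE. Qed.

Let traceD v T : base_trace (T :\ inl v)%SET = (base_trace T :\ v)%SET.
Proof. by apply/setP => u; rewrite !inE. Qed.

Let traceU_inr b T : base_trace (inr b |: T)%SET = base_trace T.
Proof. by apply/setP => u; rewrite !inE. Qed.

Let traceD_inr b T : base_trace (T :\ inr b)%SET = base_trace T.
Proof. by apply/setP => u; rewrite !inE. Qed.

Lemma two_cones_toggles X A B X' A' B' v :
  toggles X X' v -> toggles A A' v -> toggles B B' v ->
  toggles (two_cones X A B) (two_cones X' A' B') (inl v).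
Proof.
move=> [sX tX] [sA tA] [sB tB]; split => [T [nT cT]|T [nT cT] nT'].
  split => //; move: cT.
  by do 2?case: ifP => _; [exact: sA|exact: sB|exact: sX].
rewrite /two_cones !inE /= traceU traceD nT.
suff [? ?] : (if inr false \in T then A else if inr true \in T then B else X)
    (v |: base_trace T)%SET /\
  ~ (if inr false \in T then A' else if inr true \in T then B' else X')
    (base_trace T :\ v)%SET by split => // -[].
have {nT'} : ~ (if inr false \in T then A' else
    if inr true \in T then B' else X') (base_trace T) by move=> c'T; apply: nT'.
by move: cT; do 2?case: ifP => _; [exact: tA|exact: tB|exact: tX].
Qed.

(** A set of A outside B is matched with its join with the apex of the cone on
    A; no simplex of the other cone is affected. *)
Lemma two_cones_toggle_north A B :
  toggles (two_cones (A `|` B) A B) (two_cones B (A `&` B) B) (inr false).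
Proof.
split => [T [nT cT]|T [nT cT] nT'].
  split => //; move: cT; do 2?case: ifP => _ //; first by case.
  by right.
have : ~ (if inr false \in T then A `&` B else if inr true \in T then B else B)
    (base_trace T) by move=> cT'; apply: nT'.
move: cT nT; rewrite {nT'} /two_cones !inE /= traceU_inr traceD_inr.
case: ifP => _; case: ifP => // _ AT _ nABT; split.
all: try (split => //); try by move=> [_ BT]; apply: nABT; split.
- by case: AT.
- by move=> [].
Qed.

Lemma two_cones_toggle_south A B :
  toggles (two_cones B (A `&` B) B) (susp (A `&` B)) (inr true).
Proof.
split => [T [nT cT]|T [nT cT] nT'].
  by split => //; move: cT; do 2?case: ifP => _ //; case.
have : ~ (A `&` B) (base_trace T) by move=> ABT; apply: nT'; apply/suspE.
move: cT nT; rewrite {nT'} suspE /two_cones !inE /= traceU_inr traceD_inr.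
case: ifP => _ //; rewrite if_same => BT _ nABT; split; last by case.
by split.
Qed.

Lemma collapses_trans F F' F'' :
  collapses F F' -> collapses F' F'' -> collapses F F''.
Proof.
move=> FF'; elim=> // G H v _ FG dH tGH.
exact: Collapses_step FG dH tGH.
Qed.

End TwoCones.

Section TwoConesCollapse.
Variable V : finType.
Implicit Types (X A B F : set {set V}).

Lemma two_cones_collapses_north X A B A' : downclosed X -> downclosed B ->
  A `<=` X -> B `<=` X ->
  collapses A A' -> collapses (two_cones X A B) (two_cones X A' B).
Proof.
move=> dX dB AX BX AA'; elim: AA'; first exact: Collapses_refl.
move=> G H v AG IH dH tGH; apply: (Collapses_step (v := inl v) IH).
  apply: two_cones_downclosed => // S HS; apply: AX.
  exact: (collapses_sub AG (tGH.1 _ HS)).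
by apply: two_cones_toggles => //; exact: toggles_refl.
Qed.

Lemma two_cones_collapses_south X A B B' : downclosed X -> downclosed A ->
  A `<=` X -> B `<=` X ->
  collapses B B' -> collapses (two_cones X A B) (two_cones X A B').
Proof.
move=> dX dA AX BX BB'; elim: BB'; first exact: Collapses_refl.
move=> G H v BG IH dH tGH; apply: (Collapses_step (v := inl v) IH).
  apply: two_cones_downclosed => // S HS; apply: BX.
  exact: (collapses_sub BG (tGH.1 _ HS)).
by apply: two_cones_toggles => //; exact: toggles_refl.
Qed.

Lemma susp_downclosed F : downclosed F -> downclosed (susp F).
Proof. by move=> dF; exact: two_cones_downclosed. Qed.

Lemma susp_collapses F F' : collapses F F' -> collapses (susp F) (susp F').
Proof.
elim; first exact: Collapses_refl.
move=> G H v _ IH dH tGH; apply: (Collapses_step (v := inl v) IH).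
  exact: susp_downclosed.
exact: two_cones_toggles.
Qed.

Lemma two_cones_collapses_base A B : downclosed A -> downclosed B ->
  collapses A set0 -> collapses B set0 ->
  collapses (two_cones (A `|` B) A B) (two_cones (A `|` B) set0 set0).
Proof.
move=> dA dB cA cB.
have dAB : downclosed (A `|` B).
  by move=> S T ST [/(dA _ _ ST)|/(dB _ _ ST)]; [left|right].
apply: (@collapses_trans _ _ (two_cones (A `|` B) set0 B)).
  exact: two_cones_collapses_north.
exact: two_cones_collapses_south.
Qed.

Lemma two_cones_collapses_susp A B : downclosed A -> downclosed B ->
  collapses (two_cones (A `|` B) A B) (susp (A `&` B)).
Proof.
move=> dA dB.
have dAB : downclosed (A `&` B).
  by move=> S T ST [/(dA _ _ ST) ? /(dB _ _ ST)].
apply: (Collapses_step _ _ (two_cones_toggle_south A B)).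
  2: exact: susp_downclosed.
apply: (Collapses_step _ _ (two_cones_toggle_north A B)).
  exact: Collapses_refl.
by apply: two_cones_downclosed => // S [].
Qed.

Lemma renames_inl F : renames inl F (two_cones F set0 set0).
Proof.
split=> [u v []//|T]; rewrite /two_cones; split=> [[nT cT]|[iT FT]].
  move: cT; case: ifP => // Tf; case: ifP => // Tt FT.
  by split => // -[v _|[]]; [exists v|rewrite Tt|rewrite Tf].
have -> : inr false \in T = false by apply/negP => /iT[].
by have -> : inr true \in T = false by apply/negP => /iT[].
Qed.

End TwoConesCollapse.

Lemma renames_susp (V W : finType) (phi : V -> W) F F' : renames phi F F' ->
  renames (fun u => match u with inl v => inl (phi v) | inr b => inr b end)
    (susp F) (susp F').
Proof.
move=> [iphi F'E]; split.
  by move=> [u|b] [v|c] // [] => [/iphi ->|->].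
move=> T; rewrite !suspE F'E !inE.
rewrite (_ : base_trace (_ @^-1: T) = phi @^-1: base_trace T)%SET; last first.
  by apply/setP => v; rewrite !inE.
split=> [[nT [iT FT]]|[iT [nT FT]]]; split => //.
  move=> [w wT|b _]; last by exists (inr b).
  have wT' : w \in base_trace T by rewrite inE.
  by have [v ->] := iT w wT'; exists (inl v).
split => // w; rewrite inE => /iT[[v [->]|//]].
by exists v.
Qed.

Section UnionEquivalent.
Variables (R : realType) (V : finType) (A B : set {set V}).
Hypotheses (dA : downclosed A) (dB : downclosed B).
Hypotheses (cA : collapses A set0) (cB : collapses B set0).
Hypotheses (A0 : A finset.set0) (B0 : B finset.set0).

Let dAB : downclosed (A `|` B).
Proof. by move=> S T ST [/(dA ST)|/(dB ST)]; [left|right]. Qed.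

Let dcones : downclosed (two_cones (A `|` B) A B).
Proof. exact: two_cones_downclosed. Qed.

Let trace0 : base_trace (finset.set0 : {set V + bool}) = finset.set0.
Proof. by apply/setP => v; rewrite !inE. Qed.

Let base0 : two_cones (A `|` B) set0 set0 finset.set0.
Proof. by split; rewrite !inE // trace0; left. Qed.

Let susp0 : susp (A `&` B) finset.set0.
Proof. by apply/suspE; rewrite !inE trace0. Qed.

(** The cones on A and on B may be added to the union without changing the
    homotopy type because A and B collapse to the empty family, and then the
    rest of A and of B may be removed. *)
Lemma union_equivalent_susp : homotopy_equivalent R
  (polyhedron R (A `|` B)) (polyhedron R (susp (A `&` B))).
Proof.
apply: homotopy_equivalent_trans (renames_equivalent R (renames_inl _)) _.
apply: (@homotopy_equivalent_trans _ (polyhedron R (two_cones (A `|` B) A B))).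
  apply/homotopy_equivalent_sym/collapses_equivalent => //.
  exact: two_cones_collapses_base.
apply: collapses_equivalent => //; exact: two_cones_collapses_susp.
Qed.

(** The complexes of the previous proof are all suspended once more; the
    matchings do not involve the two new apices, so they remain valid. *)
Lemma susp_union_equivalent_susp : homotopy_equivalent R
  (polyhedron R (susp (A `|` B))) (polyhedron R (susp (susp (A `&` B)))).
Proof.
have trace0' : base_trace (finset.set0 : {set (V + bool) + bool}) = finset.set0.
  by apply/setP => v; rewrite !inE.
apply: homotopy_equivalent_trans
  (renames_equivalent R (renames_susp (renames_inl _))) _.
have dsg := susp_downclosed dcones.
apply: (@homotopy_equivalent_trans _
  (polyhedron R (susp (two_cones (A `|` B) A B)))).
  apply/homotopy_equivalent_sym/collapses_equivalent => //.
    exact/susp_collapses/two_cones_collapses_base.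
  by apply/suspE; rewrite !inE trace0'.
apply: collapses_equivalent => //.
  exact/susp_collapses/two_cones_collapses_susp.
by apply/suspE; rewrite !inE trace0'.
Qed.

End UnionEquivalent.

(** * The suspension of a polyhedron *)

Section SuspensionQuotient.
Local Open Scope quotient_scope.
Variable R : realType.
Local Notation I := (unit_interval R).

Definition susp_pi (X : topologicalType) (p : X * I) : suspension R X :=
  \pi_(suspension R X) p.

Lemma susp_pi_continuous (X : topologicalType) : continuous (@susp_pi X).
Proof. exact: pi_continuous. Qed.

Lemma susp_pi_surj (X : topologicalType) (z : suspension R X) :
  exists p, susp_pi p = z.
Proof. by exists (repr z); rewrite /susp_pi reprK. Qed.

Lemma susp_piP (X : topologicalType) (p q : X * I) :
  susp_pi p = susp_pi q <->
  [\/ p = q, p.2 = ui0 R /\ q.2 = ui0 R | p.2 = ui1 R /\ q.2 = ui1 R].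
Proof.
split=> [/eqmodP/or3P[/eqP|/andP[/eqP ? /eqP ?]|/andP[/eqP ? /eqP ?]]|h].
- by constructor 1.
- by constructor 2.
- by constructor 3.
apply/eqmodP/or3P; case: h => [->|[-> ->]|[-> ->]].
- by constructor 1; rewrite eqxx.
- by constructor 2; rewrite !eqxx.
- by constructor 3; rewrite !eqxx.
Qed.

Lemma suspension_lift (X Z : topologicalType) (g : X * I -> Z) :
  continuous g -> (forall p q, susp_pi p = susp_pi q -> g p = g q) ->
  exists2 h : suspension R X -> Z, continuous h & forall p, h (susp_pi p) = g p.
Proof.
move=> cg gE; exists (g \o repr).
  apply: (repr_comp_continuous cg) => p q /eqP pq; apply/eqP; exact: gE.
by move=> p /=; apply: gE; rewrite /susp_pi reprK.
Qed.

(** A continuous map induces one between the suspensions, functorially. *)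
Lemma suspension_homeomorphic (X Y : topologicalType) :
  homeomorphic X Y -> homeomorphic (suspension R X) (suspension R Y).
Proof.
have lift (Z W : topologicalType) (f : Z -> W) : continuous f ->
    exists2 h : suspension R Z -> suspension R W, continuous h &
      forall z t, h (susp_pi (z, t)) = susp_pi (f z, t).
  move=> cf.
  have [||h ch hE] := @suspension_lift Z _ (fun p => susp_pi (f p.1, p.2)).
  - apply: continuous_after (@susp_pi_continuous _) _.
    apply: continuous_pair (@continuous_snd _ _).
    exact: continuous_after cf (@continuous_fst _ _).
  - move=> p q /susp_piP pq; apply/susp_piP.
    case: pq => [->|[? ?]|[? ?]]; [by constructor 1|by constructor 2|].
    by constructor 3.
  by exists h => // z t; rewrite hE.
move=> [f [g [/lift[f' cf' f'E] /lift[g' cg' g'E] fK gK]]].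
exists f', g'; split => // z; have [[x t] <-] := susp_pi_surj z.
- by rewrite f'E g'E fK.
- by rewrite g'E f'E gK.
Qed.

Lemma suspension_compact (X : topologicalType) :
  compact [set: X] -> compact [set: suspension R X].
Proof.
move=> cX.
have cI : compact [set: I].
  by apply: set_type_compact; exact: segment_compact.
have -> : [set: suspension R X] = @susp_pi X @` ([set: X] `*` [set: I]).
  rewrite eqEsubset; split=> // z _; have [p <-] := susp_pi_surj z.
  by exists p.
apply: continuous_compact; last exact: compact_setX.
by apply: continuous_subspaceT; exact: susp_pi_continuous.
Qed.

End SuspensionQuotient.

Lemma closed_preimage (X Y : topologicalType) (f : X -> Y) (A : set Y) :
  continuous f -> closed A -> closed (f @^-1` A).
Proof. by move=> /continuous_closedP cf; exact: cf. Qed.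

Section PolyhedronCompact.
Variables (R : realType) (V : finType).
Implicit Type F : set {set V}.

Lemma polyhedron_hausdorff F : hausdorff_space (polyhedron R F).
Proof.
apply: (@hausdorff_injective _ {ptws V -> R} set_val).
- exact: continuous_set_val.
- exact: val_inj.
- by apply: hausdorff_product => _; exact: Rhausdorff.
Qed.

(** The polyhedron is closed in a cube. That the support belongs to F is a
    closed condition because F is down-closed: it says that the coordinates
    outside some member of F vanish. *)
Lemma polyhedron_compact F : downclosed F -> compact [set: polyhedron R F].
Proof.
move=> dF; apply: set_type_compact.
have ev v : continuous (fun f : {ptws V -> R} => f v).
  exact: continuous_ptws_eval.
have cube : compact [set f : {ptws V -> R} | forall v, `[0, 1]%classic (f v)].
  apply: (@tychonoff V (fun=> R : topologicalType) (fun=> `[0, 1]%classic)).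
  by move=> v; exact: segment_compact.
apply: (subclosed_compact _ cube); last first.
  move=> x [x0 x1 _] v /=; rewrite in_itv /= x0 -x1 (bigD1 v) //= lerDl.
  by rewrite sumr_ge0.
have -> : @polyhedron_set R V F =
    \bigcap_(v in [set: V]) [set x : {ptws V -> R} | 0 <= x v] `&`
    [set x : {ptws V -> R} | \sum_v x v = 1] `&`
    \bigcup_(S in F)
      \bigcap_(v in ~` [set` S]) [set x : {ptws V -> R} | x v = 0].
  rewrite eqEsubset; split=> x.
    move=> [x0 x1 xF]; split; first by split=> // v _; exact: x0.
    exists (supp x) => // v /= vx; apply/eqP/negP => /negP vx'.
    by apply: vx; rewrite inE.
  move=> [[x0 x1] [S FS xS]]; split => //; first by move=> v; exact: x0.
  apply: dF FS; apply/fintype.subsetP => v; rewrite inE.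
  by apply: contraR => vS; apply/eqP; apply: xS; apply/negP.
apply: closedI; first apply: closedI.
- apply: closed_bigI => v _.
  exact: (closed_preimage (ev v) (@closed_ge R 0)).
- have csum := @continuous_sum R _ _ (index_enum V) xpredT _ ev.
  exact: (closed_preimage csum (@closed_eq R 1)).
- apply: closed_bigcup; first exact: finite_finset.
  move=> S _; apply: closed_bigI => v _.
  exact: (closed_preimage (ev v) (@closed_eq R 0)).
Qed.

End PolyhedronCompact.

(** The point of height t over x gets mass max(0, 1 - 2t) at the lower apex
    and max(0, 2t - 1) at the upper one, the rest being distributed as in x.
    At most one apex is used, and the mass of an apex is 1 exactly at its end
    of the suspension, where x is forgotten. A vertex of F is needed to have a
    point over each of the two apices. *)
Lemma suspension_polyhedron (R : realType) (V : finType) (F : set {set V}) :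
  downclosed F -> (exists v, F [set v]%SET) ->
  homeomorphic (suspension R (polyhedron R F)) (polyhedron R (susp F)).
Proof.
move=> dF [v0 Fv0].
have F0 : F finset.set0 by apply: dF Fv0; exact: finset.sub0set.
pose P : topologicalType := (polyhedron R F * unit_interval R)%type.
pose north (p : P) : R := Num.max 0 (1 - 2 * set_val p.2).
pose south (p : P) : R := Num.max 0 (2 * set_val p.2 - 1).
pose Phi (p : P) (u : V + bool) : R := match u with
  | inl v => (1 - north p - south p) * coord p.1 v
  | inr false => north p
  | inr true => south p end.
have heights (p : P) : [\/ north p = 1 - 2 * set_val p.2 /\ south p = 0 |
                            north p = 0 /\ south p = 2 * set_val p.2 - 1].
  have [h|/ltW h] := leP (2 * set_val p.2) 1; rewrite /north /south.
    left; split; [apply/max_idPr|apply/max_idPl]; lra.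
  by right; split; [apply/max_idPl|apply/max_idPr]; lra.
have Phi0 p u : 0 <= Phi p u.
  have /andP[t0 t1] := unit_intervalP p.2.
  case: u => [v|[]] /=; rewrite ?le_max ?lexx //.
  by apply: mulr_ge0 (coord_ge0 _ _); case: (heights p) => -[-> ->]; lra.
have Phi1 p : \sum_u Phi p u = 1.
  by rewrite big_sumType /= big_bool /= -mulr_sumr coord_sum; ring.
have PhiF p : susp F (supp (Phi p)).
  apply/suspE; split.
    rewrite !inE /= -negb_or negbK.
    by case: (heights p) => -[-> ->]; rewrite eqxx ?orbT.
  apply: dF (coord_supp p.1); apply/fintype.subsetP => v; rewrite !inE /=.
  by apply: contra => /eqP ->; rewrite mulr0.
pose phi (p : P) : polyhedron R (susp F) :=
  mk_polyhedron (Phi0 p) (Phi1 p) (PhiF p).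
have cval : continuous (fun p : P => set_val p.2 : R).
  by apply: continuous_after (@continuous_snd _ _); exact: continuous_set_val.
have cc (a : R) : continuous (fun _ : P => a) by exact: cst_continuous.
have cnorth : continuous north.
  apply: continuous_max_fun (cc 0) _.
  exact: continuousB_fun (cc 1) (continuousM_fun (cc 2) cval).
have csouth : continuous south.
  apply: continuous_max_fun (cc 0) _.
  exact: continuousB_fun (continuousM_fun (cc 2) cval) (cc 1).
have cphi : continuous phi.
  apply: polyhedron_continuous => -[v|[]].
  - apply: continuousM_fun.
      exact: (continuousB_fun (continuousB_fun (cc 1) cnorth) csouth).
    exact: continuous_after (@coord_continuous R V F v) (@continuous_fst _ _).
  - exact: csouth.
  - exact: cnorth.
have phi_inj p q : phi p = phi q <-> susp_pi p = susp_pi q.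
  split=> [pq|/susp_piP[-> //|[p0 q0]|[p1 q1]]].
  - have cpq u : Phi p u = Phi q u.
      exact: (congr1 (fun z => coord z u) pq).
    have N : north p = north q by exact: (cpq (inr false)).
    have S : south p = south q by exact: (cpq (inr true)).
    have tt : p.2 = q.2.
      apply: val_inj; rewrite -[val p.2]/(set_val p.2) -[val q.2]/(set_val q.2).
      case: (heights p) (heights q) => -[pN pS] [] [qN qS]; lra.
    apply/susp_piP; have [c0|cn0] := eqVneq (1 - north p - south p) 0.
      case: (heights p) => -[pN pS]; [constructor 2|constructor 3].
        rewrite -tt; suff -> : p.2 = ui0 R by [].
        by apply: val_inj; rewrite -[val p.2]/(set_val p.2) /=; lra.
      rewrite -tt; suff -> : p.2 = ui1 R by [].
      by apply: val_inj; rewrite -[val p.2]/(set_val p.2) /=; lra.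
    constructor 1; rewrite [p]surjective_pairing [q]surjective_pairing tt.
    congr pair; apply: coord_inj => v; apply: (mulfI cn0).
    by have := cpq (inl v); rewrite /= -N -S.
  - apply: coord_inj => -[v|[]]; rewrite !coord_mk /= /north /south p0 q0 //.
    rewrite -[set_val (ui0 R)]/(0 : R) mulr0 subr0 sub0r.
    rewrite (max_idPr _) ?ler01 // (max_idPl _) ?lerN10 //.
    by rewrite !subr0 subrr !mul0r.
  - apply: coord_inj => -[v|[]]; rewrite !coord_mk /= /north /south p1 q1 //.
    rewrite -[set_val (ui1 R)]/(1 : R) mulr1.
    rewrite (max_idPl _) ?(max_idPr _); [|lra|lra].
    by rewrite -[2]/(1 + 1) addrK subr0 subrr !mul0r.
have [h ch hE] := suspension_lift cphi (fun p q => (phi_inj p q).2).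
apply: (compact_hausdorff_homeomorphic _ _ ch).
- by apply: suspension_compact; exact: polyhedron_compact.
- exact: polyhedron_hausdorff.
- move=> z z'; have [p <-] := susp_pi_surj z; have [p' <-] := susp_pi_surj z'.
  by rewrite !hE => /phi_inj.
move=> y; suff [p <-] : exists p, phi p = y by exists (susp_pi p).
have [/negP nab Ftr] := (suspE _ _).1 (coord_supp y).
pose a := coord y (inr false); pose b := coord y (inr true).
have a0 : 0 <= a by exact: coord_ge0.
have b0 : 0 <= b by exact: coord_ge0.
have ab : a = 0 \/ b = 0.
  have [->|an0] := eqVneq a 0; first by left.
  right; apply/eqP; apply/negPn/negP => bn0; apply: nab.
  by rewrite !inE an0 bn0.
pose c := \sum_v coord y (inl v).
have cab : c + (b + a) = 1.
  by have := coord_sum y; rewrite big_sumType /= big_bool.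
have c0 : 0 <= c by apply: sumr_ge0 => v _; exact: coord_ge0.
have tI : (1 - a + b) / 2 \in unit_interval R.
  rewrite inE /unit_interval /= in_itv /=; case: ab => ?; lra.
pose t : unit_interval R := exist (fun x => x \in unit_interval R) _ tI.
have tE : set_val t = (1 - a + b) / 2 by [].
have northE x : north (x, t) = a.
  by rewrite /north /= tE; case: ab => e;
    [rewrite e; apply/max_idPl|rewrite (max_idPr _)]; lra.
have southE x : south (x, t) = b.
  by rewrite /south /= tE; case: ab => e;
    [rewrite (max_idPr _)|rewrite e; apply/max_idPl]; lra.
suff [x xE] : exists x : polyhedron R F,
    forall v, c * coord x v = coord y (inl v).
  exists (x, t); apply: coord_inj => -[v|[]]; rewrite coord_mk /=.
  - by rewrite northE southE -xE; congr (_ * _); lra.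
  - exact: southE.
  - exact: northE.
have [cz|cn0] := eqVneq c 0.
  have d0 v : 0 <= (v == v0)%:R :> R by exact: ler0n.
  have d1 : \sum_v (v == v0)%:R = 1 :> R.
    by rewrite (bigD1 v0) //= eqxx big1 ?addr0 // => i /negbTE ->.
  have dFv : F (supp (fun v => (v == v0)%:R : R)).
    rewrite (_ : supp _ = [set v0]%SET) //; apply/setP => v; rewrite !inE.
    by case: (v == v0); rewrite ?oner_eq0 ?eqxx.
  exists (mk_polyhedron d0 d1 dFv) => v; rewrite cz mul0r; apply/esym/eqP.
  move: cz => /eqP; rewrite psumr_eq0 => [/allP/(_ v)|i _].
    2: exact: coord_ge0.
  by rewrite mem_index_enum; exact.
have e0 v : 0 <= coord y (inl v) / c by rewrite divr_ge0 // coord_ge0.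
have e1 : \sum_v coord y (inl v) / c = 1 by rewrite -mulr_suml divff.
have eF : F (supp (fun v => coord y (inl v) / c)).
  apply: dF Ftr; apply/fintype.subsetP => v; rewrite !inE.
  by apply: contra => /eqP ->; rewrite mul0r.
by exists (mk_polyhedron e0 e1 eF) => v; rewrite coord_mk mulrC divfK.
Qed.

(** * Sets missing a cyclic window *)

Local Open Scope nat_scope.

Lemma cone_collapses (V : finType) (F : set {set V}) v :
  (forall S, F S -> F (v |: S)%SET) -> collapses F set0.
Proof.
move=> Fv; apply: (Collapses_step (v := v) (Collapses_refl F)) => //.
by split => // S FS _; split; [exact: Fv|].
Qed.

Definition misses n (S : {set 'I_n}) (a b : nat) :=
  forall v : 'I_n, v \in S -> (v < a) || (b <= v).

Lemma misses_sub n (S T : {set 'I_n}) a b : S \subset T ->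
  misses T a b -> misses S a b.
Proof. by move=> /fintype.subsetP ST mT v /ST; exact: mT. Qed.

Lemma misses_weaken n (S : {set 'I_n}) a b c d : a <= c -> d <= b ->
  misses S a b -> misses S c d.
Proof. by move=> ac db mS v /mS; lia. Qed.

Lemma misses_setU1 n (S : {set 'I_n}) (x : 'I_n) a b : (x < a) || (b <= x) ->
  misses S a b -> misses (x |: S)%SET a b.
Proof. by move=> xab mS v; rewrite !inE => /predU1P[->|/mS]. Qed.

(** The first alternative is a window inside 0, ..., n - 1, the second one a
    window that wraps around, with p elements at the start and w - p at the
    end. The two overlap for p = 0 and p = w, which spares case
    distinctions. *)
Definition misses_window n w : set {set 'I_n} := fun S =>
  (exists i, i + w <= n /\ misses S i (i + w)) \/
  (exists p, [/\ p <= w, misses S 0 p & misses S (n - w + p) n]).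

Lemma misses_window_downclosed n w : downclosed (@misses_window n w).
Proof.
move=> S T ST [[i [iw mi]]|[p [pw m0 m1]]]; [left; exists i|right; exists p].
  by split => //; exact: misses_sub mi.
by split => //; [exact: misses_sub m0|exact: misses_sub m1].
Qed.

Lemma cyclic_intervalE n k (i v : 'I_n) : k < n ->
  (v \in cyclic_interval n (Posz i) (Posz i + Posz k)%R) =
  (i <= v <= i + k) || (i <= v + n <= i + k).
Proof.
move=> kn; rewrite inE; apply/asboolP/idP => [[m im mv]|].
  have [a am] : exists a : nat, m = Posz a by case: m im mv => // a; exists a.
  subst m; move: mv; rewrite !modz_nat => -[av].
  have iv := ltn_ord i; have vn := ltn_ord v; rewrite (modn_small vn) in av.
  have an : a < n + n by lia.
  have [an'|an'] := ltnP a n; first by rewrite modn_small // in av; lia.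
  have : a %% n = a - n.
    by rewrite -{1}(subnK an') modnDr modn_small //; lia.
  lia.
move=> /orP[h|h]; [exists (Posz v)|exists (Posz (v + n))] => //; try lia.
by rewrite !modz_nat modnDr.
Qed.

(** The complement of [i, i + k]_n is the window of length n - k - 1 that
    starts at i + k + 1; it wraps around, with i elements at the start, when i
    + k + 1 <= n. *)
Lemma nerve_misses_window n k (S : {set 'I_n}) : k < n -> S != finset.set0 ->
  S \in simplices (nerve_complex n k) <-> misses_window (n - k - 1) S.
Proof.
move=> kn S0; rewrite inE S0 /=; split.
  move=> /existsP[i /fintype.subsetP Si].
  have Si' v : v \in S -> (i <= v <= i + k) || (i <= v + n <= i + k).
    by move=> /Si; rewrite cyclic_intervalE.
  have := ltn_ord i; have [ik|ik] := leqP (i + k + 1) n => ni.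
    right; exists i; split => [|v /Si' h|v /Si' h]; first by lia.
      lia.
    by have := ltn_ord v; lia.
  left; exists (i + k + 1 - n); split; first lia.
  by move=> v /Si'; have := ltn_ord v; lia.
move=> h; apply/existsP.
suff [i iP] : exists i : 'I_n, forall v : 'I_n, v \in S ->
    (i <= v <= i + k) || (i <= v + n <= i + k).
  exists i; apply/fintype.subsetP => v vS; rewrite cyclic_intervalE //.
  exact: iP.
case: h => [[j [jn mj]]|[p [pw m0 m1]]].
  have [jn'|jn'] := ltnP (j + (n - k - 1)) n.
    exists (Ordinal jn') => v /mj /=; have := ltn_ord v; lia.
  have n0 : 0 < n by lia.
  exists (Ordinal n0) => v /mj /=; have := ltn_ord v; lia.
have pn : p < n by lia.
by exists (Ordinal pn) => v vS; have := m0 v vS; have := m1 v vS;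
  have := ltn_ord v; move=> /=; lia.
Qed.

Section Decomposition.
Variables n w : nat.
Hypothesis wn : 2 * w + 2 <= n.
Implicit Type S : {set 'I_n}.

(** The union of [inner_window] and [wrap_window] is the whole complex.
    Requiring in the latter that 0 is missed makes every case with 0 < p <= w
    literally a window through 0, turns p = 0 into the window at the end
    enlarged by 0, and gives the deletion of 0 when w = 0. *)
Definition inner_window : set {set 'I_n} := fun S =>
  exists i, [/\ 1 <= i, i + w <= n & misses S i (i + w)].

Definition wrap_window : set {set 'I_n} := fun S => misses S 0 1 /\
  exists p, [/\ p <= w, misses S 0 p & misses S (n - w + p) n].

Definition initial_gap : set {set 'I_n} := fun S => misses S 0 w.+1.

Definition separated_windows : set {set 'I_n} := fun S => misses S 0 1 /\
  exists p i, [/\ p <= w, p < i & i + w <= n] /\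
    [/\ misses S 0 p, misses S (n - w + p) n & misses S i (i + w)].

Lemma inner_window_downclosed : downclosed inner_window.
Proof.
move=> S T ST [i [i1 iw mi]]; exists i; split => //; exact: misses_sub mi.
Qed.

Lemma wrap_window_downclosed : downclosed wrap_window.
Proof.
move=> S T ST [m0 [p [pw mp mp']]]; split; first exact: misses_sub m0.
by exists p; split => //; [exact: misses_sub mp|exact: misses_sub mp'].
Qed.

Lemma initial_gap_downclosed : downclosed initial_gap.
Proof. by move=> S T ST mT; exact: misses_sub mT. Qed.

Lemma separated_windows_downclosed : downclosed separated_windows.
Proof.
move=> S T ST [m0 [p [i [h [mp mp' mi]]]]]; split; first exact: misses_sub m0.
exists p, i; split => //.
by split; [exact: misses_sub mp|exact: misses_sub mp'|exact: misses_sub mi].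
Qed.

Lemma misses_window_inner_or_wrap :
  misses_window w = inner_window `|` wrap_window.
Proof.
rewrite predeqE => S; split=> [[[i [iw mi]]|[p [pw m0 m1]]]|].
- have [i0|i0] := posnP i; last by left; exists i.
  have [w0|w0] := posnP w.
    (* The empty window may be placed anywhere. *)
    by left; exists 1; split; [lia|lia|move=> v _; lia].
  right; rewrite i0 add0n in mi; split; first exact: misses_weaken mi.
  by exists w; split => // v _; have := ltn_ord v; lia.
- have [p0|p0] := posnP p.
    left; exists (n - w); split; [lia|lia|].
    by move: m1; rewrite p0 addn0 subnK //; lia.
  by right; split; [exact: misses_weaken m0|exists p].
- case=> [[i [i0 iw mi]]|[_ [p hp]]]; first by left; exists i.
  by right; exists p.
Qed.

(** A window starting at i <= p continues the initial part of length p of the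
    wrapped window, and together they cover 0, ..., w. *)
Lemma inner_wrap_windows :
  inner_window `&` wrap_window = initial_gap `|` separated_windows.
Proof.
rewrite predeqE => S; split=> [[[i [i1 iw mi]] [m0 [p [pw mp mp']]]]|].
  have [pi|ip] := ltnP p i; first by right; split => //; exists p, i.
  by left => v vS; have := mi v vS; have := mp v vS; lia.
case=> [mC|[m0 [p [i [[pw pi iw] [mp mp' mi]]]]]].
  split.
    by exists 1; split; [lia|lia|apply: misses_weaken mC; lia].
  split; first exact: misses_weaken mC.
  exists w; split => //; first exact: misses_weaken mC.
  by move=> v _; have := ltn_ord v; lia.
split; first by exists i; split => //; lia.
by split => //; exists p.
Qed.

Let ord0n : 0 < n. Proof. lia. Qed.
Let ord1n : 1 < n. Proof. lia. Qed.
Let ordwn : w.+1 < n. Proof. lia. Qed.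

Lemma inner_window_collapses : collapses inner_window set0.
Proof.
apply: (@cone_collapses _ _ (Ordinal ord0n)) => S [i [i1 iw mi]].
by exists i; split => //; apply: misses_setU1 => //=; lia.
Qed.

Lemma wrap_window_collapses : collapses wrap_window set0.
Proof.
apply: (@cone_collapses _ _ (Ordinal ordwn)) => S [m0 [p [pw mp mp']]].
split; first by apply: misses_setU1 => //=; lia.
by exists p; split => //; apply: misses_setU1 => //=; lia.
Qed.

Lemma initial_gap_collapses : collapses initial_gap set0.
Proof.
apply: (@cone_collapses _ _ (Ordinal ordwn)) => S mS.
by apply: misses_setU1 => //=; lia.
Qed.

Let tail_free m : set {set 'I_n} :=
  fun S => separated_windows S /\ misses S (n - m) n.

Let tail_free_downclosed m : downclosed (tail_free m).
Proof.
move=> S T ST [DT mT]; split; first exact: separated_windows_downclosed DT.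
exact: misses_sub mT.
Qed.

(** When n - m - 1 is the last vertex, it is dominated by w - m: a member
    containing it misses a wrapped window with p >= w - m, hence also the one
    with p = w - m, whose part at the end consists of vertices already
    removed. The other window starts beyond p, so it does not contain w - m
    either. *)
Let tail_free_step m (mw : m < w) (xn : w - m < n) :
  toggles (tail_free m) (tail_free m.+1) (Ordinal xn).
Proof.
split=> [S [DS mS]|S [DS mS] nS].
  by split => //; apply: misses_weaken mS; lia.
have [v vS vE] : exists2 v, v \in S & v = n - m.+1 :> nat.
  apply: contrapT => nv; apply: nS; split => // v vS.
  have := mS v vS; have := ltn_ord v => vn hv.
  have : v <> n - m.+1 :> nat by move=> e; apply: nv; exists v.
  lia.
have vx : v != Ordinal xn by apply/eqP => /(congr1 val) /=; lia.
split; last first.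
  by move=> [_ /(_ v)]; rewrite !inE vx vS => /(_ isT); lia.
have [m0 [p [i [[pw pi iw] [mp mp' mi]]]]] := DS.
have pm : w - m <= p by have := mp' v vS; have := ltn_ord v; lia.
split; last by apply: misses_setU1 => //=; lia.
split; first by apply: misses_setU1 => //=; lia.
exists (w - m), i; split; first by split; lia.
split; apply: misses_setU1 => //=; try lia.
- by apply: misses_weaken mp; lia.
- by apply: misses_weaken mS; lia.
Qed.

(** Without its last w vertices the complex is a full simplex, so a cone. *)
Lemma separated_windows_collapses : collapses separated_windows set0.
Proof.
have E m : m <= w -> collapses separated_windows (tail_free m).
  elim: m => [_|m IH mw].
    rewrite (_ : tail_free 0 = separated_windows); first exact: Collapses_refl.
    rewrite predeqE => S; split=> [[]//|DS]; split => //.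
    by move=> v _; have := ltn_ord v; lia.
  have xn : w - m < n by lia.
  exact: (Collapses_step (IH (ltnW mw)) _ (tail_free_step mw xn)).
apply: collapses_trans (E w (leqnn w)) _.
apply: (@cone_collapses _ _ (Ordinal ord1n)) => S [[m0 _] mS].
have m0' : misses (Ordinal ord1n |: S)%SET 0 1 by apply: misses_setU1.
have mS' : misses (Ordinal ord1n |: S)%SET (n - w) n.
  by apply: misses_setU1 => //=; lia.
(* With p = 0 and the second window placed at the very end, nothing is required
   beyond missing 0 and the last w vertices. *)
split => //; split => //; exists 0, (n - w); split; first by split; lia.
rewrite addn0 subnK; last by lia.
by split.
Qed.

(** On sets missing 0, ..., w, only the vertices from w + 1 on matter. If the
    second window starts at i > w, it is a window of the shorter circle; if i
    <= w, its part beyond w, of length i - 1 >= p, and the part at the end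
    contain a window that wraps around the shorter circle. *)
Lemma renames_gap_separated (q : nat) (qn : forall v : 'I_q, v + w.+1 < n) :
  q = n - w.+1 ->
  renames (fun v : 'I_q => Ordinal (qn v)) (misses_window w)
    (initial_gap `&` separated_windows).
Proof.
move=> qE; split.
  by move=> u v /(congr1 val) /= uv; apply: val_inj => /=; lia.
move=> T; set phi := fun v => _; split.
  move=> [mC [m0 [p [i [[pw pi iw] [mp mp' mi]]]]]]; split.
    move=> u uT; have := mC u uT; have := ltn_ord u => un /= hu.
    have uq : u - w.+1 < q by lia.
    by exists (Ordinal uq); apply: val_inj => /=; lia.
  have [iw'|iw'] := leqP w.+1 i.
    left; exists (i - w.+1); split; first by lia.
    by move=> v; rewrite inE => /mi /=; lia.
  right; exists i.-1; split; first by lia.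
    by move=> v; rewrite inE => /mi /=; lia.
  by move=> v; rewrite inE => /mp' /=; have := ltn_ord v; lia.
move=> [im h].
have mC : initial_gap T by move=> u /im[v ->] /=; lia.
split => //; split; first exact: misses_weaken mC.
have pre u : u \in T ->
    exists2 v : 'I_q, v \in (phi @^-1: T)%SET & u = v + w.+1 :> nat.
  move=> uT; have [v uv] := im u uT.
  by exists v; [rewrite inE -[phi v]uv|rewrite uv].
case: h => [[i [iq mi]]|[p [pw mp mp']]].
  (* For p = w the wrapped window lies within 0, ..., w, which is missed. *)
  exists w, (i + w.+1); split; first by split; lia.
  split; first exact: misses_weaken mC.
    by move=> u _; have := ltn_ord u; lia.
  by move=> u /pre[v /mi + ->]; lia.
exists p, p.+1; split; first by split; lia.
split.
- by apply: misses_weaken mC; lia.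
- by move=> u /pre[v /mp' + ->]; lia.
- by move=> u /pre[v /mp + ->]; lia.
Qed.

End Decomposition.

Theorem proposition3p5 (R : realType) (n k : nat)
    (n_ge1 : (1 <= n)%N) (n_le_2k : (n <= 2 * k)%N) (k_lt_n : (k < n)%N) :
  homotopy_equivalent R
    (realization R (nerve_complex n k))
    (suspension R (suspension R
      (realization R (nerve_complex k (2 * k - n)%N)))).
Proof.
pose w := n - k - 1.
have wn : 2 * w + 2 <= n by rewrite /w; lia.
have k'k : 2 * k - n < k by lia.
have wk : k - (2 * k - n) - 1 = w by rewrite /w; lia.
set K : set {set 'I_k} :=
  fun S => S \in simplices (nerve_complex k (2 * k - n)).
have dK : downclosed (@misses_window k w) by exact: misses_window_downclosed.
have KE S : S != finset.set0 -> K S <-> misses_window w S.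
  by rewrite -wk; exact: nerve_misses_window.
set N : set {set 'I_n} := fun S => S \in simplices (nerve_complex n k).
have NE S : S != finset.set0 -> N S <-> misses_window w S.
  exact: nerve_misses_window.
have m0 a b : misses (finset.set0 : {set 'I_n}) a b by move=> v; rewrite inE.
have A0 : inner_window w (finset.set0 : {set 'I_n}).
  by exists 1; split => //; lia.
have B0 : wrap_window w (finset.set0 : {set 'I_n}) by split => //; exists 0.
have C0 : initial_gap w (finset.set0 : {set 'I_n}) by exact: m0.
have D0 : separated_windows w (finset.set0 : {set 'I_n}).
  by split => //; exists 0, 1; split; split => //; lia.
have K0 : @misses_window k w finset.set0.
  by right; exists 0; split => // v; rewrite inE.
apply: (@homotopy_equivalent_trans _ (polyhedron R (@misses_window n w))).
  apply: homeomorphic_homotopy_equivalent.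
  exact: (polyhedron_eq_homeomorphic R NE).
rewrite (misses_window_inner_or_wrap wn).
apply: homotopy_equivalent_trans (union_equivalent_susp R
  (@inner_window_downclosed n w) (@wrap_window_downclosed n w)
  (inner_window_collapses wn) (wrap_window_collapses wn) A0 B0) _.
rewrite (inner_wrap_windows wn).
apply: homotopy_equivalent_trans (susp_union_equivalent_susp R
  (@initial_gap_downclosed n w) (@separated_windows_downclosed n w)
  (initial_gap_collapses wn) (separated_windows_collapses wn) C0 D0) _.
have qn (v : 'I_k) : v + w.+1 < n by have := ltn_ord v; rewrite /w; lia.
have kE : k = n - w.+1 by rewrite /w; lia.
apply: homotopy_equivalent_trans (homotopy_equivalent_sym (renames_equivalent R
  (renames_susp (renames_susp (renames_gap_separated wn qn kE))))) _.
apply: homotopy_equivalent_sym; apply: homeomorphic_homotopy_equivalent.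
apply: (@homeomorphic_trans
  (suspension R (suspension R (polyhedron R (@misses_window k w))))).
  apply: suspension_homeomorphic; apply: suspension_homeomorphic.
  exact: (polyhedron_eq_homeomorphic R KE).
apply: (@homeomorphic_trans
  (suspension R (polyhedron R (susp (@misses_window k w))))).
  apply: suspension_homeomorphic; apply: suspension_polyhedron => //.
  have kp : 0 < k by lia.
  exists (Ordinal kp); apply/KE; last exact: simplices_vertex.
  by apply/set0Pn; exists (Ordinal kp); rewrite inE.
apply: suspension_polyhedron; first exact: susp_downclosed.
exists (inr false); apply/suspE; rewrite !inE /=; split => //.
by rewrite (_ : base_trace _ = finset.set0) //; apply/setP => v; rewrite !inE.
Qed.
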